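(* Let $k\geq 1$ and $n\geq 0$. The Munarini graph $M_{n,k}$ is isomorphic to $\Gamma_{n,k}^\star$. In particular, if $n\geq 1$, then $M_{n,k}$ is isomorphic to a subgraph of the Fibonacci cube $\Gamma_{kn-1}$.
   Context: For integers $k\geq 1$, $n\geq 0$, a $k$-generalized Pell string of length $n$ is a word of length $n$ over the alphabet $\{0,1,\ldots,k\}$ in which every maximal run of the character $k$ has even length (equivalently, a concatenation of letters from $\{0,1,\ldots,k-1,kk\}$). Let $\mathcal{F}_{n,k}$ be the set of these strings (for $n=0$ it contains only the empty string). The Munarini graph $M_{n,k}$ is the simple graph with vertex set $\mathcal{F}_{n,k}$ in which two vertices are adjacent if one of them can be obtained from the other either by replacing one occurrence of $0$ with some $i\in\{1,\ldots,k-1\}$, or by replacing one substring $00$ (two consecutive positions) with $kk$ (both replacements may be read in either direction, and both strings must be in $\mathcal{F}_{n,k}$). The Fibonacci cube $\Gamma_m$ is the subgraph of the hypercube $Q_m$ (vertex set $\{0,1\}^m$, two strings adjacent iff they differ in exactly one coordinate) induced by the binary strings of length $m$ with no two consecutive $1$s; $\Gamma_0=K_1$. Let $A_0=0^k$ and $A_i=0^{i-1}10^{k-i}$ for $i\in\{1,\ldots,k\}$ (binary strings of length $k$). A Munarini string is a binary string that is a concatenation of zero or more strings from $\{A_0,A_1,\ldots,A_{k-1},A_kA_0\}$. Let $\mathcal{F}_{n,k}^\star$ be the set of Munarini strings of length $kn$ (they have no two consecutive $1$s), and let $\Gamma_{n,k}^\star$ be the subgraph of $\Gamma_{kn}$ induced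 by $\mathcal{F}_{n,k}^\star$. *)

(* Defs.v *)
From HB Require Import structures.
From mathcomp Require Import all_boot.

Set Implicit Arguments.
Unset Strict Implicit.
Unset Printing Implicit Defensive.

Record sgraph := SGraph {
  vertex :> finType;
  adj : rel vertex;
  adj_sym : symmetric adj;
  adj_irr : irreflexive adj }.

Definition isomorphic (G H : sgraph) : Prop :=
  exists f : G -> H, bijective f /\ forall x y, adj (f x) (f y) = adj x y.

Section Subgraphs.
Variable G : sgraph.

Section Induced.
Variable P : pred G.
Definition induced_adj : rel {x : G | P x} := fun x y => adj (val x) (val y).
Lemma induced_sym : symmetric induced_adj.
Proof. by move=> x y; apply: adj_sym. Qed.
Lemma induced_irr : irreflexive induced_adj.
Proof. by move=> x; apply: adj_irr. Qed.
Definition induced : sgraph := SGraph induced_sym induced_irr.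
End Induced.

(* Not necessarily induced: any set of vertices, with any set of edges of G   *)
(* between them.                                                              *)
Record subgraph := Subgraph {
  sub_vertices : {set G};
  sub_adj : rel G;
  sub_adj_sym : symmetric sub_adj;
  sub_adj_edge : forall x y, sub_adj x y -> adj x y;
  sub_adj_vertices :
    forall x y, sub_adj x y -> (x \in sub_vertices) && (y \in sub_vertices) }.

Section ToSgraph.
Variable H : subgraph.
Definition subgraph_adj : rel {x : G | x \in sub_vertices H} :=
  fun x y => sub_adj H (val x) (val y).
Lemma subgraph_sym : symmetric subgraph_adj.
Proof. by move=> x y; apply: sub_adj_sym. Qed.
Lemma subgraph_irr : irreflexive subgraph_adj.
Proof. by move=> x; apply/negP => /sub_adj_edge; rewrite adj_irr. Qed.
Definition sgraph_of_subgraph : sgraph := SGraph subgraph_sym subgraph_irr.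
End ToSgraph.
End Subgraphs.

Coercion sgraph_of_subgraph : subgraph >-> sgraph.

Section Munarini.
Variables n k : nat.
Implicit Types w : n.-tuple 'I_k.+1.

(* The letter k is ord_max : 'I_k.+1. The positions p with i <= p < j form a  *)
(* maximal run of it.                                                         *)
Definition max_run w (i j : nat) : bool :=
  [&& i < j,
      [forall p : 'I_n, (i <= p < j) ==> (tnth w p == ord_max)] &
      [forall p : 'I_n, (p.+1 == i) || (p == j :> nat) ==>
                        (tnth w p != ord_max)]].

Definition pell_string w : bool :=
  [forall i : 'I_n.+1, forall j : 'I_n.+1, max_run w i j ==> ~~ odd (j - i)].

Definition replace_letter : rel (n.-tuple 'I_k.+1) := fun w w' =>
  [exists p : 'I_n,
    [&& tnth w p == ord0, 0 < tnth w' p < k &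
        [forall q : 'I_n, (q != p) ==> (tnth w' q == tnth w q)]]].

Definition replace_pair : rel (n.-tuple 'I_k.+1) := fun w w' =>
  [exists p : 'I_n, exists p' : 'I_n,
    [&& p' == p.+1 :> nat,
        tnth w p == ord0, tnth w p' == ord0,
        tnth w' p == ord_max, tnth w' p' == ord_max &
        [forall q : 'I_n, (q != p) && (q != p') ==> (tnth w' q == tnth w q)]]].

Definition replace : rel (n.-tuple 'I_k.+1) :=
  fun w w' => replace_letter w w' || replace_pair w w'.

Definition munarini_adj : rel {w : n.-tuple 'I_k.+1 | pell_string w} :=
  fun x y => replace (val x) (val y) || replace (val y) (val x).

Lemma munarini_sym : symmetric munarini_adj.
Proof. by move=> x y; apply: orbC. Qed.

Lemma munarini_irr : 0 < k -> irreflexive munarini_adj.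
Proof.
move=> k_gt0 x; rewrite /munarini_adj orbb; apply/negP => /orP[].
  by case/existsP=> p /and3P[/eqP->].
case/existsP=> p /existsP[p' /and5P[_ /eqP-> _ /eqP/(congr1 val)/= k0 _]].
by rewrite -k0 in k_gt0.
Qed.

Definition munarini_graph (k_gt0 : 0 < k) : sgraph :=
  SGraph munarini_sym (munarini_irr k_gt0).
End Munarini.

Section Hypercube.
Variable m : nat.
Definition hypercube_adj : rel (m.-tuple bool) :=
  fun x y => #|[set i | tnth x i != tnth y i]| == 1.
Lemma hypercube_sym : symmetric hypercube_adj.
Proof.
move=> x y; rewrite /hypercube_adj; congr (_ == 1); apply: eq_card => i.
by rewrite !inE eq_sym.
Qed.
Lemma hypercube_irr : irreflexive hypercube_adj.
Proof.
move=> x; rewrite /hypercube_adj (_ : [set _ | _] = set0) ?cards0 //.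
by apply/setP=> i; rewrite !inE eqxx.
Qed.
Definition hypercube : sgraph := SGraph hypercube_sym hypercube_irr.

Definition fibonacci_string (x : m.-tuple bool) : bool :=
  [forall i : 'I_m, forall j : 'I_m,
    (j == i.+1 :> nat) ==> ~~ (tnth x i && tnth x j)].

Definition fibonacci_cube : sgraph := @induced hypercube fibonacci_string.
End Hypercube.

Section MunariniStrings.
Variable k : nat.

Definition A (i : nat) : seq bool :=
  if i == 0 then nseq k false else nseq i.-1 false ++ true :: nseq (k - i) false.

(* The generators A_0, ..., A_{k-1}, A_k A_0, indexed by 0, ..., k.           *)
Definition munarini_block (i : 'I_k.+1) : seq bool :=
  if i == ord_max then A k ++ A 0 else A i.

(* At most size s generators are allowed, so that the predicate is boolean;   *)
(* no generator is empty when k >= 1, so this is no restriction: see          *)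
(* munarini_stringP.                                                          *)
Definition munarini_string (s : seq bool) : bool :=
  [exists bs : {bseq (size s) of 'I_k.+1},
    s == flatten [seq munarini_block i | i <- bs]].

Lemma size_A i : 0 < k -> i <= k -> size (A i) = k.
Proof.
move=> k_gt0 ik; rewrite /A; case: eqP => [_|/eqP i0]; first by rewrite size_nseq.
rewrite size_cat /= !size_nseq addnS -addSn prednK ?lt0n //.
by rewrite subnKC.
Qed.

Lemma size_munarini_block i : 0 < k -> 0 < size (munarini_block i).
Proof.
move=> k_gt0; rewrite /munarini_block; case: ifP => _.
  by rewrite size_cat size_A // ltn_addr.
by rewrite size_A // -ltnS.
Qed.

Lemma munarini_stringP s : 0 < k ->
  reflect (exists bs : seq 'I_k.+1, s = flatten [seq munarini_block i | i <- bs])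
          (munarini_string s).
Proof.
move=> k_gt0; apply: (iffP existsP) => [[bs /eqP E]|[bs E]]; first by exists bs.
suff sz : size bs <= size s by exists (Bseq sz); apply/eqP.
rewrite {s}E; elim: bs => //= i bs IH; rewrite size_cat.
by rewrite -add1n leq_add // size_munarini_block.
Qed.
End MunariniStrings.

Lemma munarini_string_fibonacci k m (x : m.-tuple bool) :
  0 < k -> munarini_string k x -> fibonacci_string x.
Proof.
move=> k_gt0 /(munarini_stringP _ k_gt0)[bs E].
pose R (a b : bool) := ~~ (a && b).
pose good s := path R false s && ~~ last false s.
have good_nil : good [::] by [].
have good_cat s t : good s -> good t -> good (s ++ t).
  by case/andP=> ps ls /andP[pt lt]; rewrite /good cat_path last_cat ps (negPf ls) pt.
have p0 j : path R false (nseq j false) by elim: j.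
have l0 j : last false (nseq j false) = false by elim: j.
have p1 j : path R true (nseq j false) by case: j => //= j; rewrite p0.
have l1 j : last true (nseq j false) = (j == 0) by case: j => //= j; rewrite l0.
have goodA i : i < k -> good (A k i).
  move=> ik; rewrite /good /A; case: eqP => _; first by rewrite p0 l0.
  by rewrite cat_path last_cat /= p0 l0 p1 l1 /= -lt0n subn_gt0.
have goodkk : good (A k k ++ A k 0).
  rewrite /good /A eqxx -[k == 0]negbK -lt0n k_gt0 /= subnn -catA.
  rewrite cat_path p0 l0 /= p1 last_cat /= l1.
  by rewrite -lt0n.
have : good (x : seq bool).
  rewrite E; elim: bs {E} => //= i bs IH; apply: good_cat => //.
  rewrite /munarini_block; case: eqP => // /eqP i_max; apply: goodA.
  by rewrite ltn_neqAle -ltnS ltn_ord andbT.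
case/andP=> /(pathP false) Px _; apply/forallP=> i; apply/forallP=> j.
apply/implyP=> /eqP ij; have := Px j; rewrite size_tuple ltn_ord => /(_ isT).
by rewrite ij /= -ij !(tnth_nth false).
Qed.

Definition munarini_subcube (n k : nat) : sgraph :=
  @induced (fibonacci_cube (k * n))
           (fun x => munarini_string k (val x)).

(* Main.v *)
Require Import Defs.
From mathcomp Require Import all_boot.
From mathcomp Require Import zify.

Set Implicit Arguments.
Unset Strict Implicit.
Unset Printing Implicit Defensive.

(** In a Pell string, replace each pair [kk] by [k0]: the result, called here a
    reduced word, is a word in which every letter [k] is followed by a [0], and
    [kk] can be recovered from it.  Both kinds of edges of the Munarini graph
    become the replacement of a single letter [0] by a nonzero letter.  Encoding
    every letter [i] of the reduced word by [A_i], distinct letters [i], [j] are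
    at Hamming distance [(i != 0) + (j != 0)], so two encoded words are at
    distance 1 exactly when they differ in one letter, which is [0] in one of
    them.  Finally every Munarini string ends with a [0], which can be dropped. *)

(** * Graphs *)

(** Spares an explicit inverse: surjectivity bounds the cardinality of [U] by that of [T]. *)
Lemma inj_surj_bij (T U : finType) (f : T -> U) :
  injective f -> (forall y, exists x, f x = y) -> bijective f.
Proof.
move=> f_inj f_surj; apply: inj_card_bij f_inj _.
have /subset_leq_card : [set: U] \subset f @: [set: T].
  by apply/subsetP=> y _; have [x <-] := f_surj y; apply: imset_f.
by move/leq_trans/(_ (leq_imset_card _ _)); rewrite !cardsT.
Qed.

(** The subgraph is the image of [f] with all edges of [H] inside it; as [f] reflects adjacency,
    these are exactly the images of the edges of [G]. *)
Lemma isomorphic_subgraph (G H : sgraph) (f : G -> H) :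
  injective f -> (forall x y, adj (f x) (f y) = adj x y) ->
  exists S : subgraph H, isomorphic G S.
Proof.
move=> f_inj f_adj.
pose V := f @: [set: G].
pose e : rel H := fun x y => [&& adj x y, x \in V & y \in V].
have e_sym : symmetric e by move=> x y; rewrite /e adj_sym [(x \in V) && _]andbC.
have e_edge x y : e x y -> adj x y by case/and3P.
have e_vert x y : e x y -> (x \in V) && (y \in V) by case/and3P=> _ -> ->.
have fV x : f x \in V by apply: imset_f; rewrite inE.
exists (Subgraph e_sym e_edge e_vert).
exists (fun x => exist _ (f x) (fV x)); split.
  apply: inj_surj_bij => [x y [/f_inj]|[y yV]] //.
  by have /imsetP[x _ yx] := yV; exists x; apply: val_inj.
by move=> x y; rewrite /adj /= /subgraph_adj /= /e !fV !andbT f_adj.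
Qed.

(** * Hamming distance *)

Section Distance.
Variables (T : Type) (d : T -> T -> nat).

(** Serves both for bits and, with [letter_dist], for letters. The longer list is truncated, so
    [hamming_encode] needs no hypothesis on sizes. *)
Fixpoint seq_dist (s t : seq T) : nat :=
  match s, t with
  | x :: s', y :: t' => d x y + seq_dist s' t'
  | _, _ => 0
  end.

Lemma seq_dist_cat s1 s2 t1 t2 : size s1 = size t1 ->
  seq_dist (s1 ++ s2) (t1 ++ t2) = seq_dist s1 t1 + seq_dist s2 t2.
Proof. by elim: s1 t1 => [|x s1 IH] [|y t1] //= [/IH ->]; rewrite addnA. Qed.

Lemma seq_dist_id s : (forall x, d x x = 0) -> seq_dist s s = 0.
Proof. by move=> d0; elim: s => //= x s ->; rewrite d0. Qed.

End Distance.

Notation hamming := (seq_dist (fun x y : bool => (x != y) : nat)).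

Lemma hamming_sym s t : hamming s t = hamming t s.
Proof. by elim: s t => [|x s IH] [|y t] //=; rewrite IH eq_sym. Qed.

Lemma card_neq_hamming m (x y : m.-tuple bool) :
  #|[set i | tnth x i != tnth y i]| = hamming x y.
Proof.
rewrite -sum1dep_card big_mkcond /=.
elim: m x y => [|m IH] x y; first by rewrite big_ord0 !tuple0.
case/tupleP: x => a x; case/tupleP: y => b y.
rewrite big_ord_recl !tnth0 /= -IH; congr (_ + _).
by apply: eq_bigr => i _; rewrite !tnthS.
Qed.

Lemma hypercube_adjE m (x y : m.-tuple bool) :
  hypercube_adj x y = (hamming x y == 1).
Proof. by rewrite /hypercube_adj card_neq_hamming. Qed.

(** * Pell strings and reduced words *)

Section Words.
Variable k : nat.
Hypothesis k_gt0 : 0 < k.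
Notation letter := 'I_k.+1.
Implicit Types (u w a c : seq letter) (x i j : letter) (b : bool).

Lemma ord0_neq_max : (ord0 == ord_max :> letter) = false.
Proof. by apply/eqP=> /(congr1 val) /= k0; move: k_gt0; rewrite -k0. Qed.

(* The state [b] says that the letter just read is an odd-numbered [k] of its
   run. *)
Definition parity_step b x := (x == ord_max) && ~~ b.

Fixpoint pell_from b w : bool :=
  if w is x :: w' then ((x == ord_max) || ~~ b) && pell_from (parity_step b x) w'
  else ~~ b.

Fixpoint reduce b w : seq letter :=
  if w is x :: w' then
    (if (x == ord_max) && b then ord0 else x) :: reduce (parity_step b x) w'
  else [::].

(** Here [b] says that the previous letter is [ord_max]; no parity is involved, since [ord0] must
    follow. *)
Fixpoint reduced_from b u : bool :=
  if u is x :: u' then (b ==> (x == ord0)) && reduced_from (x == ord_max) u'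
  else ~~ b.

Fixpoint expand b u : seq letter :=
  if u is x :: u' then (if b then ord_max else x) :: expand (x == ord_max) u'
  else [::].

Lemma size_reduce b w : size (reduce b w) = size w.
Proof. by elim: w b => //= x w IH b; rewrite IH. Qed.

Lemma size_expand b u : size (expand b u) = size u.
Proof. by elim: u b => //= x u IH b; rewrite IH. Qed.

(** Both scans share the state [b]: after each letter of a Pell word, the parity state is true
    exactly when the reduced letter just written is [ord_max]. *)
Lemma reduced_reduce b w : pell_from b w -> reduced_from b (reduce b w).
Proof.
elim: w b => //= x w IH b /andP[xb /IH].
rewrite /parity_step; case: eqP xb => [->|/eqP/negPf nx] /=.
  by case: b => /=; rewrite ?ord0_neq_max ?eqxx.
by case: b => //=; rewrite nx.
Qed.

Lemma reduceK b w : pell_from b w -> expand b (reduce b w) = w.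
Proof.
elim: w b => //= x w IH b /andP[xb /IH].
rewrite /parity_step; case: eqP xb => [->|/eqP/negPf nx] /=.
  by case: b => /=; rewrite ?ord0_neq_max ?eqxx => _ ->.
by case: b => //=; rewrite nx => _ ->.
Qed.

Lemma pell_expand b u : reduced_from b u -> pell_from b (expand b u).
Proof.
elim: u b => //= x u IH [] /= => [/andP[/eqP-> /IH]|/IH].
  by rewrite /parity_step eqxx ord0_neq_max.
by rewrite /parity_step orbT andbT.
Qed.

Lemma expandK b u : reduced_from b u -> reduce b (expand b u) = u.
Proof.
elim: u b => //= x u IH [] /= => [/andP[/eqP-> /IH]|/IH].
  by rewrite /parity_step eqxx ord0_neq_max /= => ->.
by rewrite /parity_step andbF andbT => ->.
Qed.

Lemma pell_from_cat b a c : pell_from b (a ++ c) ->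
  pell_from (foldl parity_step b a) c.
Proof. by elim: a b => //= x a IH b /andP[_ /IH]. Qed.

Lemma reduce_cat b a c :
  reduce b (a ++ c) = reduce b a ++ reduce (foldl parity_step b a) c.
Proof. by elim: a b => //= x a IH b; rewrite IH. Qed.

Lemma reduced_from_cat b a c : reduced_from b (a ++ c) ->
  reduced_from (foldl (fun _ x => x == ord_max) b a) c.
Proof. by elim: a b => //= x a IH b /andP[_ /IH]. Qed.

Lemma expand_cat b a c :
  expand b (a ++ c) =
  expand b a ++ expand (foldl (fun _ x => x == ord_max) b a) c.
Proof. by elim: a b => //= x a IH b; rewrite IH. Qed.

(** * Replacements as raising one letter of the reduced word *)

Definition raise_letter u u' : Prop := exists a i c,
  [/\ i != ord0, u = a ++ ord0 :: c & u' = a ++ i :: c].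

Definition seq_replace w w' : Prop :=
  (exists a i c, [/\ 0 < i < k, w = a ++ ord0 :: c & w' = a ++ i :: c]) \/
  (exists a c, w = a ++ [:: ord0, ord0 & c] /\
               w' = a ++ [:: ord_max, ord_max & c]).

(** The replaced [ord0] is read in state false, as [w] is Pell. Both words reach [c] in state false
    again, so [c] is reduced alike; a new pair [kk] reduces to [k0], which differs from [00] in its
    first letter only. *)
Lemma raise_letter_reduce w w' : pell_from false w ->
  seq_replace w w' -> raise_letter (reduce false w) (reduce false w').
Proof.
move=> pw [[a [i [c [/andP[i0 ik] wE ->]]]]|[a [c [wE ->]]]];
  move: pw; rewrite {}wE => /pell_from_cat; rewrite !reduce_cat;
  case: (foldl _ _ _) => /=; rewrite ?ord0_neq_max //= => _.
- have nk : (i == ord_max) = false by apply/eqP=> ie; move: ik; rewrite ie ltnn.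
  exists (reduce false a), i, (reduce false c).
  by rewrite /parity_step nk ord0_neq_max /= -val_eqE /= -lt0n i0.
- exists (reduce false a), ord_max, (ord0 :: reduce false c).
  by rewrite /parity_step eqxx ord0_neq_max /= eq_sym ord0_neq_max.
Qed.

(** Since [u'] is reduced and [i] is nonzero, no [ord_max] precedes [i]. If [i] is [ord_max], then
    [c] starts with [ord0], so [00] becomes [k0], which expands to [kk]. *)
Lemma seq_replace_expand u u' : reduced_from false u' ->
  raise_letter u u' -> seq_replace (expand false u) (expand false u').
Proof.
move=> ru' [a [i [c [i0 -> uE]]]]; move: ru'; rewrite {}uE => /reduced_from_cat.
rewrite !expand_cat; case: (foldl _ _ _) => /=; first by rewrite (negPf i0).
rewrite ord0_neq_max; case: (eqVneq i ord_max) => [->|ik].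
  case: c => [|x c] //= /andP[/eqP -> _]; rewrite ord0_neq_max.
  by right; exists (expand false a), (expand false c).
move=> _; left; exists (expand false a), i, (expand false c); split=> //.
by move: i0 ik (ltn_ord i); rewrite -!val_eqE /=; lia.
Qed.

(** * The parity scan and maximal runs *)

Lemma pell_fromP b w :
  pell_from b w <->
  forall j : nat, j <= size w -> (j < size w -> nth ord0 w j != ord_max) ->
    foldl parity_step b (take j w) = false.
Proof.
elim: w b => [|x w IH] b /=.
  by split; [move/negPf=> nb; case | move/(_ 0)=> ->].
(* The condition asks for state false wherever a run may end: before another letter or at the end of
   the word. Here [j = 0] treats the first letter and [j.+1] the rest. *)
split; last move=> H.
  case/andP=> xb /IH pw [|j] /= jw nj; last exact: pw.
  by move: (nj isT) xb => /negPf-> /negPf.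
apply/andP; split; last by apply/IH => j jw; apply: (H j.+1).
by case: eqP => //= /eqP nx; apply/negbT/(H 0).
Qed.

(** The witness [i] is the start of the run of [ord_max] that ends at [j], with [i = j] if it is
    empty. One more letter either extends the run or restarts it at [j.+1]. *)
Lemma parity_run w (j : nat) : j <= size w -> exists i : nat,
  [/\ i <= j, forall p, i <= p < j -> nth ord0 w p = ord_max,
      forall p, p.+1 = i -> nth ord0 w p != ord_max &
      foldl parity_step false (take j w) = odd (j - i)].
Proof.
elim: j => [|j IH] jw; first by exists 0; rewrite take0; split=> // p; lia.
have [i [ij run_i start_i par_i]] := IH (ltnW jw).
rewrite (take_nth ord0) // foldl_rcons /parity_step -/parity_step {}par_i.
case: (eqVneq (nth ord0 w j)) => [wj|wj].
  exists i; split=> //; first by lia.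
    by move=> p pij; case: (eqVneq p j) => [->|pj] //; apply: run_i; lia.
  by rewrite subSn.
exists j.+1; split=> //; last by rewrite subnn.
  by move=> p; lia.
by move=> p [->].
Qed.

Lemma pell_stringE n (w : n.-tuple letter) : pell_string w = pell_from false w.
Proof.
apply/idP/idP => [/forallP H|/pell_fromP H].
  apply/pell_fromP => j jw nj.
  have [i [ij run_i start_i ->]] := parity_run jw.
  rewrite size_tuple in jw nj.
  (* An empty run has even length; a nonempty one is a maximal run, to which [H] applies. *)
  have [->|ltij] := eqVneq i j; first by rewrite subnn.
  have iw : i < n.+1 by rewrite ltnS (leq_trans ij).
  have := H (Ordinal iw) => /forallP/(_ (Ordinal (jw : j < n.+1)))/implyP /=.
  move=> Hij; apply/negbTE/Hij/and3P; split; first by rewrite ltn_neqAle ltij.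
    apply/forallP=> p; apply/implyP=> /run_i.
    by rewrite (tnth_nth ord0) => ->.
  apply/forallP=> p; apply/implyP; rewrite (tnth_nth ord0).
  by case/orP=> /eqP pi; [apply: start_i | rewrite pi nj // -pi].
apply/forallP=> -[i0 i0n]; apply/forallP=> -[j jn]; apply/implyP=> /and3P[/= i0j].
move=> /forallP run_i0 /forallP end_i0.
have jw : j <= size w by rewrite size_tuple.
have nj : j < size w -> nth ord0 w j != ord_max.
  rewrite size_tuple => jn'; have := end_i0 (Ordinal jn').
  by rewrite /= eqxx orbT (tnth_nth ord0).
have [i [ij run_i start_i par]] := parity_run jw.
move: (H j jw nj); rewrite {}par => /negbT.
suff -> : i = i0 by [].
have wp p (pn : p < n) : tnth w (Ordinal pn) = nth ord0 w p by apply: tnth_nth.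
(* The letter before the later of two distinct starts would be [ord_max], as part of the longer run,
   and also not [ord_max], as it precedes the shorter one. *)
case: (ltngtP i0 i) => // lt_i; exfalso.
  have pn : i.-1 < n by lia.
  have := run_i0 (Ordinal pn); rewrite wp /=.
  have -> : i0 <= i.-1 < j by lia.
  by apply/negP/start_i; lia.
have pn : i0.-1 < n by lia.
have := end_i0 (Ordinal pn); rewrite wp /= run_i ?eqxx ?implybF; last by lia.
by rewrite prednK ?eqxx //; lia.
Qed.

(** * Edges of the Munarini graph on lists *)

Lemma split_nth w p : p < size w -> w = take p w ++ nth ord0 w p :: drop p.+1 w.
Proof. by move=> pw; rewrite -drop_nth // cat_take_drop. Qed.

Lemma eq_take w w' p : size w = size w' ->
  (forall q, q < size w -> q < p -> nth ord0 w' q = nth ord0 w q) ->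
  take p w' = take p w.
Proof.
move=> sz eqw; apply: (@eq_from_nth _ ord0) => [|q]; first by rewrite !size_take sz.
by rewrite size_take => qp; rewrite !nth_take ?eqw //; move: qp; case: ifP; lia.
Qed.

Lemma eq_drop w w' p : size w = size w' ->
  (forall q, q < size w -> p <= q -> nth ord0 w' q = nth ord0 w q) ->
  drop p w' = drop p w.
Proof.
move=> sz eqw; apply: (@eq_from_nth _ ord0) => [|q]; first by rewrite !size_drop sz.
by rewrite size_drop => qp; rewrite !nth_drop eqw //; lia.
Qed.

Lemma replaceP n (w w' : n.-tuple letter) :
  replace w w' <-> seq_replace w w'.
Proof.
have sz : size w = size w' by rewrite !size_tuple.
have wp (t : n.-tuple letter) (p : 'I_n) : tnth t p = nth ord0 t p by apply: tnth_nth.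
have ltw (t : n.-tuple letter) a x c : tval t = a ++ x :: c -> size a < n.
  by move/(congr1 size); rewrite size_cat size_tuple /=; lia.
split.
- case/orP.
  + case/existsP=> p /and3P[/eqP w0 wi /forallP eqw].
    have {}eqw q : q < size w -> q != p -> nth ord0 w' q = nth ord0 w q.
      rewrite size_tuple => qn qp; have := eqw (Ordinal qn).
      by rewrite -val_eqE /= qp !wp /= => /eqP.
    left; exists (take p w), (tnth w' p), (drop p.+1 w); split=> //.
      by rewrite -w0 wp -split_nth // size_tuple.
    rewrite wp {1}(@split_nth w' p) ?size_tuple // (@eq_take w) //; last first.
      by move=> q qw qp; apply: eqw => //; lia.
    by rewrite (@eq_drop w) // => q qw qp; apply: eqw => //; lia.
  + case/existsP=> p /existsP[p' /and5P[/eqP pp' /eqP wp0 /eqP wp0' /eqP wpk]].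
    case/andP=> /eqP wpk' /forallP eqw.
    have {}eqw q : q < size w -> q != p -> q != p.+1 -> nth ord0 w' q = nth ord0 w q.
      rewrite size_tuple => qn qp qp'; have := eqw (Ordinal qn).
      by rewrite -!val_eqE /= pp' qp qp' !wp /= => /eqP/val_inj.
    have pn : p.+1 < n by rewrite -pp'.
    have split2 (t : n.-tuple letter) : tval t =
        take p t ++ [:: nth ord0 t p, nth ord0 t p.+1 & drop p.+2 t].
      by rewrite -!drop_nth ?cat_take_drop // size_tuple // ltnW.
    rewrite !wp pp' in wp0 wp0' wpk wpk'.
    right; exists (take p w), (drop p.+2 w); split.
      by rewrite {1}split2 wp0 wp0'.
    rewrite {1}split2 wpk wpk' (@eq_take w) //; last first.
      by move=> q qw qp; apply: eqw => //; lia.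
    by rewrite (@eq_drop w) // => q qw qp; apply: eqw => //; lia.
- case=> [[a [i [c [i0k wE w'E]]]]|[a [c [wE w'E]]]]; apply/orP.
  + left; apply/existsP; exists (Ordinal (ltw _ _ _ _ wE)).
    rewrite !wp /= wE w'E !nth_cat ltnn subnn /= ?eqxx i0k /=.
    apply/forallP=> q; rewrite -val_eqE !wp /= wE w'E !nth_cat.
    apply/implyP=> qa; case: ltnP => // aq.
    (* Past the changed position the index into [i :: c] is positive; written as a successor, it
       lets [nth] skip the head, where alone the words differ. *)
    by have -> : q - size a = (q - size a).-1.+1 by lia.
  + have an := ltw _ _ _ _ wE.
    have an' : (size a).+1 < n.
      by have := congr1 size wE; rewrite size_cat size_tuple /=; lia.
    right; apply/existsP; exists (Ordinal an).
    apply/existsP; exists (Ordinal an').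
    rewrite !wp /= wE w'E !nth_cat ltnn subnn [_.+1 < _]ltnNge leqnSn subSnn /=.
    rewrite ?eqxx /=.
    apply/forallP=> q; rewrite -!val_eqE !wp /= wE w'E !nth_cat.
    apply/implyP=> qa; case: ltnP => // aq.
    by have -> : q - size a = (q - size a).-2.+2 by lia.
Qed.

(** * Binary encoding *)

Definition letter_dist i j : nat :=
  if i == j then 0 else (i != ord0) + (j != ord0).

Lemma letter_dist_id i : letter_dist i i = 0.
Proof. by rewrite /letter_dist eqxx. Qed.

Lemma letter_dist_eq0 i j : letter_dist i j = 0 -> i = j.
Proof.
rewrite /letter_dist; case: eqP => // ij.
by case: (eqVneq i) ij => [->|] //=; case: (eqVneq j) => // ->.
Qed.

(** Numbering the positions from 1 makes [A k 0] the zero vector without a special case. *)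
Lemma A_unit_vector i : A k i = [seq p == i :> nat | p <- iota 1 k].
Proof.
have ik : i <= k by rewrite -ltnS.
apply: (@eq_from_nth _ false) => [|p]; rewrite size_A // ?size_map ?size_iota //.
move=> pk; rewrite (nth_map 0) ?size_iota // nth_iota // /A.
case: eqP => i0; first by rewrite nth_nseq pk i0.
rewrite nth_cat size_nseq nth_nseq; case: ltnP => pi; first by lia.
case: (eqVneq p i.-1) => [->|npi]; first by rewrite subnn /=; lia.
have -> : p - i.-1 = (p - i.-1).-1.+1 by lia.
by rewrite /= nth_nseq; case: ifP; lia.
Qed.

(** The window starts at an arbitrary [o] for the induction on [m]; each of two distinct unit
    vectors contributes 1 if its position lies in the window. *)
Lemma hamming_unit_vector (i j m o : nat) :
  hamming [seq p == i | p <- iota o m] [seq p == j | p <- iota o m] =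
  if i == j then 0 else (o <= i < o + m) + (o <= j < o + m).
Proof.
elim: m o => [|m IH] o /=; first by case: ifP => _ //; lia.
by rewrite IH; case: (eqVneq i j) => [->|ij]; [rewrite eqxx | lia].
Qed.

Lemma hamming_A i j : hamming (A k i) (A k j) = letter_dist i j.
Proof.
rewrite !A_unit_vector hamming_unit_vector /letter_dist -!val_eqE /=.
by have := ltn_ord i; have := ltn_ord j; case: ifP => //; lia.
Qed.

Definition encode u : seq bool := flatten [seq A k (i : letter) | i <- u].

Lemma size_letter i : size (A k i) = k.
Proof. by rewrite size_A // -ltnS. Qed.

Lemma size_encode u : size (encode u) = k * size u.
Proof.
elim: u => [|x u IH]; first by rewrite muln0.
by rewrite /encode /= size_cat size_letter -/(encode u) IH mulnS.
Qed.

Lemma hamming_encode u u' :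
  hamming (encode u) (encode u') = seq_dist letter_dist u u'.
Proof.
elim: u u' => [|x u IH] [|y u'] //=.
  by rewrite /encode /=; case: (_ ++ _).
by rewrite seq_dist_cat ?size_letter // hamming_A -IH.
Qed.

(** * Words at distance 0 or 1 *)

Lemma seq_dist_letter_eq0 u u' : size u = size u' ->
  seq_dist letter_dist u u' = 0 -> u = u'.
Proof.
elim: u u' => [|x u IH] [|y u'] //= [/IH IHu'] /eqP.
by rewrite addn_eq0 => /andP[/eqP/letter_dist_eq0-> /eqP/IHu'->].
Qed.

Lemma encode_inj u u' : size u = size u' -> encode u = encode u' -> u = u'.
Proof.
move=> szu eu; apply: seq_dist_letter_eq0 => //.
by rewrite -hamming_encode eu seq_dist_id // => b; rewrite eqxx.
Qed.

Lemma seq_dist_raise u u' : raise_letter u u' -> seq_dist letter_dist u u' = 1.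
Proof.
case=> a [i [c [i0 -> ->]]].
rewrite seq_dist_cat //= !(seq_dist_id _ letter_dist_id).
by rewrite /letter_dist eq_sym (negPf i0) eqxx.
Qed.

Lemma raise_seq_dist u u' : size u = size u' ->
  seq_dist letter_dist u u' = 1 -> raise_letter u u' \/ raise_letter u' u.
Proof.
elim: u u' => [|x u IH] [|y u'] //= [szu]; case: (eqVneq x y) => [->|xy].
  rewrite letter_dist_id => /(IH _ szu)[] [a [i [c [i0 -> ->]]]]; [left|right];
    by exists (y :: a), i, c.
(* Distinct heads already contribute at least 1, so the tails agree; a contribution of exactly 1
   means that one head is [ord0]. *)
rewrite {1}/letter_dist (negPf xy) => D1.
have /(seq_dist_letter_eq0 szu) eu : seq_dist letter_dist u u' = 0.
  move: D1 xy; case: (eqVneq x ord0) => [->|_]; case: (eqVneq y ord0) => //= _; lia.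
move: D1; rewrite -{}eu.
case: (eqVneq x ord0) xy => [-> y0 _|x0 _]; first by left; exists [::], y, u; rewrite eq_sym.
by case: (eqVneq y ord0) => [-> _|//]; right; exists [::], x, u.
Qed.

(** * Munarini strings as codes of reduced words *)

Lemma last_A d i : last d (A k i) = (i == ord_max).
Proof.
have l0 e m : last e (nseq m.+1 false) = false by elim: m e => //=.
rewrite /A -val_eqE /=; case: (eqVneq (i : nat) 0) => [->|i0].
  (* Since [k] is positive, [A k 0] is nonempty and its last bit does not depend on the default
     [d]. *)
  by case: k k_gt0 => // k' _; rewrite l0.
rewrite last_cat /=; have := ltn_ord i; rewrite ltnS leq_eqVlt.
case: eqP => [->|_] /=; first by rewrite subnn.
by rewrite -subn_gt0; case: (k - i) => // m _; rewrite l0.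
Qed.

(** The default [b] stands for the last bit of the preceding block, true exactly after [ord_max]; a
    reduced word cannot end in that state. *)
Lemma last_encode b u : reduced_from b u -> last b (encode u) = false.
Proof.
elim: u b => [[]|x u IH b] //= /andP[_ /IH].
by rewrite /encode /= last_cat last_A.
Qed.

Lemma munarini_encode u : reduced_from false u -> munarini_string k (encode u).
Proof.
(* After a letter [ord_max] the block [A k k] is held back until the following [ord0] completes the
   generator [A k k ++ A k 0]. *)
suff gen b : reduced_from b u -> exists bs : seq letter,
    (if b then A k k else [::]) ++ encode u = flatten (map (@munarini_block k) bs).
  by move/gen=> [bs E]; apply/munarini_stringP => //; exists bs.
elim: u b => [[]|x u IH [] /=] //; first by exists [::].
  case/andP=> /eqP->; rewrite ord0_neq_max => /IH[bs E]; exists (ord_max :: bs).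
  by rewrite /= -E /munarini_block eqxx /encode /= catA.
move/IH=> [bs]; case: eqP => [->|/eqP nx] E; first by exists bs.
by exists (x :: bs); rewrite /= -E /munarini_block (negPf nx).
Qed.

(** The generator [A k k ++ A k 0] is read as the two letters [k0], any other as one letter below
    [k], so the word obtained is reduced. *)
Lemma munarini_decode s : munarini_string k s ->
  exists2 u, reduced_from false u & s = encode u.
Proof.
case/munarini_stringP => // bs ->; elim: bs => [|i bs [u ru E]] /=.
  by exists [::].
rewrite {}E; case: (eqVneq i ord_max) => [->|ni].
  exists [:: ord_max, ord0 & u]; first by rewrite /= !eqxx ord0_neq_max.
  by rewrite /= /munarini_block eqxx /encode /= catA.
exists (i :: u); first by rewrite /= (negPf ni).
by rewrite /= /munarini_block (negPf ni).
Qed.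

(** * The binary code of a Pell string *)

Definition word_code w : seq bool := encode (reduce false w).

Lemma size_word_code n (w : n.-tuple 'I_k.+1) : size (word_code w) == k * n.
Proof. by rewrite size_encode size_reduce size_tuple. Qed.

Lemma word_code_munarini n (w : n.-tuple 'I_k.+1) :
  pell_string w -> munarini_string k (word_code w).
Proof. by rewrite pell_stringE => /reduced_reduce/munarini_encode. Qed.

Lemma word_code_inj n (w w' : n.-tuple 'I_k.+1) :
  pell_string w -> pell_string w' -> word_code w = word_code w' -> w = w'.
Proof.
rewrite !pell_stringE => pw pw' /encode_inj; rewrite !size_reduce !size_tuple.
by move=> /(_ erefl) E; apply: val_inj; rewrite /= -(reduceK pw) E reduceK.
Qed.

Lemma word_code_surj n (s : seq bool) : size s = k * n -> munarini_string k s ->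
  exists2 w : n.-tuple 'I_k.+1, pell_string w & word_code w = s.
Proof.
move=> sz /munarini_decode[u ru sE].
move/eqP: sz; rewrite {}sE size_encode // eqn_pmul2l // => un.
have wn : size (expand false u) == n by rewrite size_expand.
exists (Tuple wn); first by rewrite pell_stringE pell_expand.
by rewrite /word_code /= expandK.
Qed.

(** Codes at distance 1 come from reduced words one of which raises a letter of the other; which one
    it is decides the direction of the replacement. *)
Lemma hamming_word_code n (w w' : n.-tuple 'I_k.+1) :
  pell_string w -> pell_string w' ->
  (hamming (word_code w) (word_code w') == 1) = replace w w' || replace w' w.
Proof.
rewrite !pell_stringE hamming_encode => pw pw'.
have sz : size (reduce false w) = size (reduce false w').
  by rewrite !size_reduce !size_tuple.
apply/eqP/orP => [/(raise_seq_dist sz)|].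
  by case=> /(seq_replace_expand (reduced_reduce _)); rewrite !reduceK // => H;
    [left | right]; apply/replaceP/H.
case=> /replaceP/raise_letter_reduce => [/(_ pw)|/(_ pw')] /seq_dist_raise //.
by rewrite -!hamming_encode hamming_sym.
Qed.

Lemma word_code_rcons n (w : n.-tuple 'I_k.+1) : 0 < n -> pell_string w ->
  word_code w = rcons (take (k * n - 1) (word_code w)) false.
Proof.
rewrite pell_stringE => n_gt0 /reduced_reduce/last_encode.
have /eqP := size_word_code w; rewrite /word_code.
(* As [k * n] is positive, the code is nonempty and has a last bit. *)
case/lastP: (encode _) => [|s x]; first by move=> /= /esym/eqP; lia.
by rewrite size_rcons last_rcons => <- ->; rewrite subn1 /= -!cats1 take_size_cat.
Qed.

End Words.

(** * Dropping the last bit, and the two isomorphisms *)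

Lemma fibonacci_string_rcons m m' (x : m.-tuple bool) (y : m'.-tuple bool) b :
  tval y = rcons x b -> fibonacci_string y -> fibonacci_string x.
Proof.
move=> yx /forallP fib_y; have mm' : m <= m'.
  by rewrite -(size_tuple y) yx size_rcons size_tuple.
have xy i : tnth x i = tnth y (widen_ord mm' i).
  by rewrite !(tnth_nth false) yx nth_rcons size_tuple /= ltn_ord.
apply/forallP=> i; apply/forallP=> j; rewrite !xy.
by have /forallP := fib_y (widen_ord mm' i); apply.
Qed.

Theorem theorem3p1 (k n : nat) (k_gt0 : 0 < k) :
  isomorphic (munarini_graph n k_gt0) (munarini_subcube n k) /\
  (0 < n -> exists H : subgraph (fibonacci_cube (k * n - 1)),
              isomorphic (munarini_graph n k_gt0) H).
Proof.
pose code (w : munarini_graph n k_gt0) := Tuple (size_word_code k_gt0 (val w)).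
have code_mun w : munarini_string k (code w).
  by apply: word_code_munarini => //; apply: (valP w).
have code_fib w : fibonacci_string (code w).
  exact: munarini_string_fibonacci (code_mun w).
split.
  pose f w : munarini_subcube n k :=
    exist _ (exist _ (code w) (code_fib w) : fibonacci_cube (k * n)) (code_mun w).
  exists f; split.
    apply: inj_surj_bij => [w w' [E]|[[y y_fib] y_mun]].
      by apply/val_inj/(word_code_inj k_gt0 (valP w) (valP w') E).
    have [w pw E] := word_code_surj k_gt0 (size_tuple y) y_mun.
    (* The three layers are the Munarini subtype, the Fibonacci subtype and the tuple. *)
    by exists (exist _ w pw); do 3 apply: val_inj.
  move=> w w'; rewrite /adj /= /induced_adj /= /adj /= /induced_adj /=.
  by rewrite hypercube_adjE hamming_word_code ?(valP w) ?(valP w').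
move=> n_gt0.
have size_trunc w : size (take (k * n - 1) (code w)) == k * n - 1.
  by rewrite size_takel // size_tuple leq_subr.
pose trunc w := Tuple (size_trunc w).
have truncK w : tval (code w) = rcons (trunc w) false.
  by apply: word_code_rcons => //; apply: (valP w).
have trunc_fib w : fibonacci_string (trunc w).
  exact: fibonacci_string_rcons (truncK w) (code_fib w).
pose g w : fibonacci_cube (k * n - 1) := exist _ (trunc w) (trunc_fib w).
apply: (@isomorphic_subgraph _ _ g) => [w w' [E]|w w'].
  apply/val_inj/(word_code_inj k_gt0 (valP w) (valP w')).
  by rewrite -[LHS]/(tval (code w)) -[RHS]/(tval (code w')) !truncK /= E.
rewrite /adj /= /induced_adj /= hypercube_adjE /munarini_adj.
rewrite -hamming_word_code ?(valP w) ?(valP w') //.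
(* Both codes end in [false], so dropping that bit changes no distance. *)
rewrite -[word_code (val w)]/(tval (code w)) -[word_code (val w')]/(tval (code w')).
by rewrite !truncK -!cats1 seq_dist_cat ?size_tuple //= !addn0.
Qed.
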